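(* Fix $d\in\{2,3\}$, a weakly connected directed graph $\mathcal G=([n],\mathcal E)$, weights $\kappa_{ij},\tau_{ij}>0$ for $(i,j)\in\mathcal E$, and ground-truth poses $(\underline R_i,\underline t_i)\in\mathrm{SO}(d)\times\mathbb R^d$, $i\in[n]$. Let $\underline Q$ be the connection Laplacian constructed using the true relative transformations $\underline R_{ij}=\underline R_i^\top\underline R_j$, $\underline t_{ij}=\underline R_i^\top(\underline t_j-\underline t_i)$. There exists a constant $\delta>0$ such that the following holds for all measurements $\widetilde R_{ij}\in\mathrm{SO}(d)$, $\widetilde t_{ij}\in\mathbb R^d$, $(i,j)\in\mathcal E$, with connection Laplacian $Q$. If $\|Q-\underline Q\|_2<\delta$, then every minimizer $Z^\star$ of the semidefinite program $$\min_{Z\in\mathbb S_+^{(d+1)n}}\ \langle Q,Z\rangle\quad\text{s.t. } Z_{[i,i](1:d,1:d)}=I_d\ \ \forall i\in[n]$$ has its first $d\times(d+1)n$ block row given by $$Z^\star_{(1:d,:)}=\begin{bmatrix}R_1^\star & t_1^\star&\cdots&R_n^\star&t_n^\star\end{bmatrix},$$ where $\{R_i^\star,t_i^\star\}$ is an optimal solution of the pose-graph optimization problem $$\min_{R_i\in\mathrm{SO}(d),\,t_i\in\mathbb R^d}\ \sum_{(i,j)\in\mathcal E}\kappa_{ij}\|R_j-R_i\widetilde R_{ij}\|_F^2+\tau_{ij}\|t_j-t_i-R_i\widetilde t_{ij}\|_2^2 .$$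
   Context: The graph has vertex set $[n]=\{1,\dots,n\}$ and no self-loops. $\langle A,B\rangle=\operatorname{tr}(A^\top B)$, $\|\cdot\|_2$ for matrices is the spectral norm, and $\mathbb S^m_+$ is the set of $m\times m$ symmetric positive semidefinite matrices. Given measurements $(\widetilde R_{ij},\widetilde t_{ij})_{(i,j)\in\mathcal E}$, the connection Laplacian $Q$ is the unique symmetric $(d+1)n\times(d+1)n$ matrix such that for all $r\ge1$ and all $X=[Y_1\ p_1\ \cdots\ Y_n\ p_n]$ with $Y_i\in\mathbb R^{r\times d}$, $p_i\in\mathbb R^r$, $$\langle Q,X^\top X\rangle=\sum_{(i,j)\in\mathcal E}\kappa_{ij}\|Y_j-Y_i\widetilde R_{ij}\|_F^2+\tau_{ij}\|p_j-p_i-Y_i\widetilde t_{ij}\|_2^2 .$$ $\underline Q$ is the same matrix with $(\widetilde R_{ij},\widetilde t_{ij})$ replaced by $(\underline R_{ij},\underline t_{ij})$ (same weights). $Z$ is viewed as an $n\times n$ array of $(d+1)\times(d+1)$ blocks $Z_{[i,j]}$; $Z_{[i,i](1:d,1:d)}$ is the top-left $d\times d$ submatrix of $Z_{[i,i]}$, and $Z_{(1:d,:)}$ denotes the first $d$ rows of $Z$. *)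

(* Defs.v *)
From HB Require Import structures.
From mathcomp Require Import all_boot all_order all_algebra.
From mathcomp Require Import boolp classical_sets reals.

Set Implicit Arguments.
Unset Strict Implicit.
Unset Printing Implicit Defensive.

Import Order.TTheory GRing.Theory Num.Theory.

Local Open Scope ring_scope.

(* [n * (d + 1)], in the form that lets MathComp's block-matrix operations
   ([submxblock], [submxcol], [\mxrow]) see n blocks of size d + 1. *)
Notation pgdim d n := (\sum_(i < n) (d + 1))%N (only parsing).

Definition mxdot (R : realType) (m n : nat) (A B : 'M[R]_(m, n)) : R :=
  \tr (A^T *m B).

(* The Frobenius norm; on column vectors it is the Euclidean norm. *)
Definition frobnorm (R : realType) (m n : nat) (A : 'M[R]_(m, n)) : R :=
  Num.sqrt (mxdot A A).

Definition specnorm (R : realType) (m n : nat) (A : 'M[R]_(m, n)) : R :=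
  sup [set frobnorm (A *m x) | x in [set x : 'cV[R]_n | frobnorm x <= 1]]%classic.

Definition psd (R : realType) (m : nat) (Z : 'M[R]_m) : Prop :=
  Z^T = Z /\ forall x : 'cV[R]_m, 0 <= (x^T *m Z *m x) 0 0.

Definition SO (R : realType) (d : nat) (A : 'M[R]_d) : Prop :=
  A^T *m A = 1%:M /\ \det A = 1.

Definition weakly_connected (n : nat) (E : rel 'I_n) : Prop :=
  forall i j : 'I_n, connect [rel u v | E u v || E v u] i j.

(* [Y_1 p_1 ... Y_n p_n] *)
Definition stack (R : realType) (d n r : nat)
    (Y : 'I_n -> 'M[R]_(r, d)) (p : 'I_n -> 'cV[R]_r) :
    'M[R]_(r, pgdim d n) :=
  \mxrow_(i < n) row_mx (Y i) (p i).

(* The measurements [Rm i j], [tm i j] only matter when [E i j]. *)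
Definition pgo_cost (R : realType) (d n r : nat) (E : rel 'I_n)
    (kappa tau : 'I_n -> 'I_n -> R)
    (Rm : 'I_n -> 'I_n -> 'M[R]_d) (tm : 'I_n -> 'I_n -> 'cV[R]_d)
    (Y : 'I_n -> 'M[R]_(r, d)) (p : 'I_n -> 'cV[R]_r) : R :=
  \sum_(i < n) \sum_(j < n | E i j)
    (kappa i j * frobnorm (Y j - Y i *m Rm i j) ^+ 2 +
     tau i j * frobnorm (p j - p i - Y i *m tm i j) ^+ 2).

(* Exactly one matrix satisfies this; see [connection_laplacian_existsU]. *)
Definition is_connection_laplacian (R : realType) (d n : nat) (E : rel 'I_n)
    (kappa tau : 'I_n -> 'I_n -> R)
    (Rm : 'I_n -> 'I_n -> 'M[R]_d) (tm : 'I_n -> 'I_n -> 'cV[R]_d)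
    (Q : 'M[R]_(pgdim d n)) : Prop :=
  Q^T = Q /\
  forall (r : nat), (0 < r)%N ->
  forall (Y : 'I_n -> 'M[R]_(r, d)) (p : 'I_n -> 'cV[R]_r),
    mxdot Q ((stack Y p)^T *m stack Y p) = pgo_cost E kappa tau Rm tm Y p.

Definition sdp_feasible (R : realType) (d n : nat) (Z : 'M[R]_(pgdim d n)) :
    Prop :=
  psd Z /\ forall i : 'I_n, ulsubmx (submxblock Z i i) = 1%:M :> 'M[R]_d.

Definition sdp_minimizer (R : realType) (d n : nat) (Q Z : 'M[R]_(pgdim d n)) :
    Prop :=
  sdp_feasible Z /\
  forall Z' : 'M[R]_(pgdim d n), sdp_feasible Z' -> mxdot Q Z <= mxdot Q Z'.

Definition pgo_optimal (R : realType) (d n : nat) (E : rel 'I_n)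
    (kappa tau : 'I_n -> 'I_n -> R)
    (Rm : 'I_n -> 'I_n -> 'M[R]_d) (tm : 'I_n -> 'I_n -> 'cV[R]_d)
    (Rs : 'I_n -> 'M[R]_d) (ts : 'I_n -> 'cV[R]_d) : Prop :=
  (forall i, SO (Rs i)) /\
  forall (Rs' : 'I_n -> 'M[R]_d) (ts' : 'I_n -> 'cV[R]_d),
    (forall i, SO (Rs' i)) ->
    pgo_cost E kappa tau Rm tm Rs ts <= pgo_cost E kappa tau Rm tm Rs' ts'.

(* The first d rows: the top d rows of the first block row. *)
Definition first_rows (R : realType) (d n : nat) (Z : 'M[R]_(pgdim d n.+1)) :
    'M[R]_(d, pgdim d n.+1) :=
  usubmx (submxcol Z ord0).

Lemma mxdotE (R : realType) (m k : nat) (A : 'M[R]_(m, k)) :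
  mxdot A A = \sum_j \sum_i A i j ^+ 2.
Proof.
by apply: eq_bigr => j _; rewrite mxE; apply: eq_bigr => i _; rewrite mxE.
Qed.

Lemma mxdot_ge0 (R : realType) (m k : nat) (A : 'M[R]_(m, k)) : 0 <= mxdot A A.
Proof.
by rewrite mxdotE sumr_ge0 // => j _; rewrite sumr_ge0 // => i _; apply: sqr_ge0.
Qed.

Lemma frobnorm_sqr (R : realType) (m k : nat) (A : 'M[R]_(m, k)) :
  frobnorm A ^+ 2 = mxdot A A.
Proof. by rewrite sqr_sqrtr ?mxdot_ge0. Qed.

(* So [sup] does not take its junk value in [specnorm]. *)
Lemma specnorm_has_sup (R : realType) (m n : nat) (A : 'M[R]_(m, n)) :
  has_sup [set frobnorm (A *m x) | x in
             [set x : 'cV[R]_n | frobnorm x <= 1]]%classic.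
Proof.
split.
  exists (frobnorm (A *m (0 : 'cV_n))); exists 0 => //=.
  by rewrite /frobnorm /mxdot mulmx0 raddf0 sqrtr0 ler01.
exists (Num.sqrt (\sum_i (\sum_j `|A i j|) ^+ 2)) => _ [x /= x1 <-].
have xj j : `|x j 0| <= 1.
  rewrite -[leRHS]sqrtr1 -sqrtr_sqr ler_wsqrtr //.
  apply: (@le_trans _ _ (mxdot x x)); last first.
    by rewrite -frobnorm_sqr expr_le1 // sqrtr_ge0.
  rewrite mxdotE big_ord1 (bigD1 j) //= lerDl sumr_ge0 // => i _.
  exact: sqr_ge0.
rewrite ler_wsqrtr // mxdotE big_ord1; apply: ler_sum => i _.
rewrite -real_normK ?num_real // lerXn2r ?nnegrE ?normr_ge0 ?sumr_ge0 //.
rewrite mxE (le_trans (ler_norm_sum _ _ _)) //; apply: ler_sum => j _.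
by rewrite normrM ler_piMr.
Qed.

Lemma mxdot_gram (R : realType) (N r k : nat) (X : 'M[R]_(r, N))
    (B : 'M[R]_(N, k)) :
  mxdot (B *m B^T) (X^T *m X) = frobnorm (X *m B) ^+ 2.
Proof.
rewrite frobnorm_sqr /mxdot !trmx_mul trmxK.
by rewrite -mulmxA mxtrace_mulC !mulmxA.
Qed.

Definition selY (R : realType) (d n : nat) (i : 'I_n) : 'M[R]_(pgdim d n, d) :=
  \mxcol_(k < n) (if k == i then col_mx 1%:M 0 else 0).

Definition selp (R : realType) (d n : nat) (i : 'I_n) : 'cV[R]_(pgdim d n) :=
  \mxcol_(k < n) (if k == i then col_mx 0 1%:M else 0).

Lemma stack_selY (R : realType) (d n r : nat)
    (Y : 'I_n -> 'M[R]_(r, d)) (p : 'I_n -> 'cV[R]_r) i :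
  stack Y p *m selY R d i = Y i.
Proof.
rewrite mul_mxrow_mxcol (bigD1 i) //= eqxx mul_row_col mulmx1 mulmx0 addr0.
by rewrite big1 ?addr0 // => k /negPf->; rewrite mulmx0.
Qed.

Lemma stack_selp (R : realType) (d n r : nat)
    (Y : 'I_n -> 'M[R]_(r, d)) (p : 'I_n -> 'cV[R]_r) i :
  stack Y p *m selp R d i = p i.
Proof.
rewrite mul_mxrow_mxcol (bigD1 i) //= eqxx mul_row_col mulmx1 mulmx0 add0r.
by rewrite big1 ?addr0 // => k /negPf->; rewrite mulmx0.
Qed.

Lemma stack_surj (R : realType) (d n r : nat) (X : 'M[R]_(r, pgdim d n)) :
  X = stack (fun i => lsubmx (submxrow X i : 'M_(r, d + 1)))
            (fun i => rsubmx (submxrow X i : 'M_(r, d + 1))).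
Proof.
rewrite -[LHS]submxrowK; apply: eq_mxrow => i.
by rewrite hsubmxK.
Qed.

Lemma sym_quad_eq0 (R : realType) (N : nat) (D : 'M[R]_N) :
  D^T = D -> (forall x : 'rV[R]_N, mxdot D (x^T *m x) = 0) -> D = 0.
Proof.
move=> sD D0.
have q0 (x : 'rV[R]_N) : x *m D *m x^T = 0.
  by rewrite [LHS]mx11_scalar -trace_mx11 -mulmxA mxtrace_mulC -mulmxA -{1}sD
             [\tr _]D0 raddf0.
have bil (i j : 'I_N) :
    (delta_mx 0 i : 'rV[R]_N) *m D *m (delta_mx 0 j : 'rV[R]_N)^T = (D i j)%:M.
  by rewrite -rowE [LHS]mx11_scalar trmx_delta -colE !mxE.
apply/matrixP => i j; rewrite mxE.
have := q0 (delta_mx 0 i + delta_mx 0 j).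
rewrite linearD mulmxDl mulmxDl !mulmxDr !q0 add0r addr0 !bil.
have -> : D j i = D i j by rewrite -{1}sD mxE.
by move/matrixP/(_ 0 0); rewrite !mxE -mulr2n => /eqP; rewrite mulrn_eq0 => /eqP.
Qed.

Lemma connection_laplacian_existsU (R : realType) (d n : nat) (E : rel 'I_n)
    (kappa tau : 'I_n -> 'I_n -> R)
    (Rm : 'I_n -> 'I_n -> 'M[R]_d) (tm : 'I_n -> 'I_n -> 'cV[R]_d) :
  exists! Q, is_connection_laplacian E kappa tau Rm tm Q.
Proof.
pose B i j := selY R d j - selY R d i *m Rm i j.
pose c i j := selp R d j - selp R d i - selY R d i *m tm i j.
pose Q0 := \sum_(i < n) \sum_(j < n | E i j)
  (kappa i j *: (B i j *m (B i j)^T) + tau i j *: (c i j *m (c i j)^T)).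
have [sQ0 hQ0] : is_connection_laplacian E kappa tau Rm tm Q0.
  split.
    rewrite !linear_sum; apply: eq_bigr => i _ /=.
    rewrite linear_sum; apply: eq_bigr => j _ /=.
    by rewrite linearD /= !linearZ /= !trmx_mul !trmxK.
  move=> r _ Y p.
  rewrite {1}/mxdot !linear_sum /= mulmx_suml linear_sum; apply: eq_bigr => i _.
  rewrite linear_sum /= mulmx_suml linear_sum; apply: eq_bigr => j _ /=.
  rewrite linearD /= !linearZ /= mulmxDl linearD /= -!scalemxAl !linearZ /=.
  rewrite -!/(mxdot _ _) !mxdot_gram /B /c !mulmxBr !mulmxA.
  by rewrite !stack_selY !stack_selp.
exists Q0; split=> // Q' [sQ' hQ'].
apply/eqP; rewrite -subr_eq0; apply/eqP/sym_quad_eq0.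
  by rewrite linearB /= sQ0 sQ'.
move=> x; rewrite (stack_surj x) /mxdot linearB /= mulmxBl linearB /=.
by rewrite -!/(mxdot _ _) hQ0 // hQ' // subrr.
Qed.

(* Main.v *)
(* Write a minimizer as Z = X^T X with X = [Y_1 p_1 ... Y_n p_n], translated so
   that p_1 = 0. Comparing <Q, Z> with the value at the true poses bounds the
   noiseless cost <Q0, Z> by O(|Q - Q0|), and along the connected graph this cost
   controls the deviation of the Y_i R0_i^T from each other.
   Optimality of X under rotations of a single Y_i (acting on the left, so r is
   not constrained) and under changes of a single p_i gives X Q = X Lambda with
   Lambda block diagonal; Lambda is small because |X Q0|^2 is at most a multiple
   of <Q0, X^T X>. Hence W = (1 - Y_1 Y_1^T) X, whose first block vanishes,
   satisfies <Q, W^T W> = <Lambda, W^T W>, so <Q0, W^T W> is at most a small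
   multiple of |W|^2; by coercivity W = 0, i.e., Y_i = Y_1 R_i with R_i = Y_1^T Y_i
   orthogonal, and det R_i = 1 because R_i is close to R0_1^T R0_i.
   Finally the projection by Y_1^T does not increase the cost, and the
   semidefinite program is a relaxation of pose-graph optimization. *)
Require Import Defs.
From mathcomp Require Import all_boot all_order all_algebra.
From mathcomp Require Import boolp classical_sets reals.
From mathcomp Require Import ring lra.

Set Implicit Arguments.
Unset Strict Implicit.
Unset Printing Implicit Defensive.

Import Order.TTheory GRing.Theory Num.Theory.

Local Open Scope ring_scope.

(** * Frobenius inner product and norm *)

Section Frobenius.
Variable R : realType.

Lemma mxdot_sumE m n (A B : 'M[R]_(m, n)) :
  mxdot A B = \sum_j \sum_i A i j * B i j.
Proof.
by apply: eq_bigr => j _; rewrite mxE; apply: eq_bigr => i _; rewrite mxE.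
Qed.

Lemma mxdotC m n (A B : 'M[R]_(m, n)) : mxdot A B = mxdot B A.
Proof. by rewrite /mxdot -mxtrace_tr trmx_mul trmxK. Qed.

Lemma mxdotDl m n (A B C : 'M[R]_(m, n)) :
  mxdot (A + B) C = mxdot A C + mxdot B C.
Proof. by rewrite /mxdot linearD mulmxDl linearD. Qed.

Lemma mxdotDr m n (A B C : 'M[R]_(m, n)) :
  mxdot A (B + C) = mxdot A B + mxdot A C.
Proof. by rewrite /mxdot mulmxDr linearD. Qed.

Lemma mxdotZl m n (a : R) (A B : 'M[R]_(m, n)) :
  mxdot (a *: A) B = a * mxdot A B.
Proof. by rewrite /mxdot linearZ -scalemxAl linearZ. Qed.

Lemma mxdotZr m n (a : R) (A B : 'M[R]_(m, n)) :
  mxdot A (a *: B) = a * mxdot A B.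
Proof. by rewrite /mxdot -scalemxAr linearZ. Qed.

Lemma mxdotNl m n (A B : 'M[R]_(m, n)) : mxdot (- A) B = - mxdot A B.
Proof. by rewrite -scaleN1r mxdotZl mulN1r. Qed.

Lemma mxdotNr m n (A B : 'M[R]_(m, n)) : mxdot A (- B) = - mxdot A B.
Proof. by rewrite -scaleN1r mxdotZr mulN1r. Qed.

Lemma mxdotBl m n (A B C : 'M[R]_(m, n)) :
  mxdot (A - B) C = mxdot A C - mxdot B C.
Proof. by rewrite mxdotDl mxdotNl. Qed.

Lemma mxdot0l m n (A : 'M[R]_(m, n)) : mxdot 0 A = 0.
Proof. by rewrite -(scale0r A) mxdotZl mul0r. Qed.

Lemma mxdot_mull m n p (A : 'M[R]_(m, n)) (B : 'M_(n, p)) (C : 'M_(m, p)) :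
  mxdot (A *m B) C = mxdot B (A^T *m C).
Proof. by rewrite /mxdot trmx_mul mulmxA. Qed.

Lemma mxdot_mulr m n p (A : 'M[R]_(m, n)) (B : 'M_(n, p)) (C : 'M_(m, p)) :
  mxdot (A *m B) C = mxdot A (C *m B^T).
Proof. by rewrite /mxdot trmx_mul -mulmxA mxtrace_mulC mulmxA. Qed.

Lemma frobnorm_ge0 m n (A : 'M[R]_(m, n)) : 0 <= frobnorm A.
Proof. exact: sqrtr_ge0. Qed.

Lemma frobnorm0 m n : frobnorm (0 : 'M[R]_(m, n)) = 0.
Proof. by rewrite /frobnorm mxdot0l sqrtr0. Qed.

Lemma frobnorm0_eq0 m n (A : 'M[R]_(m, n)) : frobnorm A ^+ 2 <= 0 -> A = 0.
Proof.
rewrite frobnorm_sqr mxdotE => A0; apply/matrixP => i j; rewrite mxE.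
have /eqP : \sum_j \sum_i A i j ^+ 2 = 0.
  by apply/le_anti; rewrite A0 /=; do 2!apply: sumr_ge0 => ? _; apply: sqr_ge0.
rewrite psumr_eq0 => [/allP/(_ j)|k _]; last first.
  by apply: sumr_ge0 => ? _; apply: sqr_ge0.
rewrite mem_index_enum /= => /(_ isT).
rewrite psumr_eq0 => [/allP/(_ i)|k _]; last exact: sqr_ge0.
by rewrite mem_index_enum /= sqrf_eq0 => /(_ isT)/eqP.
Qed.

Lemma frobnormN m n (A : 'M[R]_(m, n)) : frobnorm (- A) = frobnorm A.
Proof. by rewrite /frobnorm mxdotNl mxdotNr opprK. Qed.

Lemma frobnormC m n (A B : 'M[R]_(m, n)) : frobnorm (A - B) = frobnorm (B - A).
Proof. by rewrite -frobnormN opprB. Qed.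

Lemma frobnorm_tr m n (A : 'M[R]_(m, n)) : frobnorm A^T = frobnorm A.
Proof. by rewrite /frobnorm /mxdot trmxK mxtrace_mulC. Qed.

(** A derivative-free first-order test. With [c = 1 + |b| > b], the point [s = - a / c] gives the
    value [(a / c)^2 (b - c)], which is negative unless [a = 0]. *)
Lemma quad_ge0_linear0 (a b : R) : (forall s, 0 <= a * s + b * s ^+ 2) -> a = 0.
Proof.
move=> h; apply/eqP/negP => /negP a0.
pose c := 1 + `|b|; have c0 : 0 < c by rewrite ltr_pwDl.
have := h (- a / c).
have bc : b <= c - 1 by rewrite /c addrAC subrr add0r ler_norm.
have -> : a * (- a / c) + b * (- a / c) ^+ 2 = (a / c) ^+ 2 * (b - c).
  by field; rewrite gt_eqF.
rewrite pmulr_rge0 ?subr_ge0; last first.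
  by rewrite exprn_even_gt0 //= mulf_neq0 ?invr_eq0 // gt_eqF.
lra.
Qed.

(** Cauchy-Schwarz, by expanding the squared norm of [|B|^2 A - <A, B> B]. *)
Lemma mxdot_sqr_le m n (A B : 'M[R]_(m, n)) :
  mxdot A B ^+ 2 <= frobnorm A ^+ 2 * frobnorm B ^+ 2.
Proof.
have [B0|B0] := leP (frobnorm B ^+ 2) 0.
  by rewrite (frobnorm0_eq0 B0) mxdotC mxdot0l expr0n mulr_ge0 ?sqr_ge0.
have := mxdot_ge0 (frobnorm B ^+ 2 *: A - mxdot A B *: B).
rewrite !(mxdotDl, mxdotDr, mxdotNl, mxdotNr, mxdotZl, mxdotZr).
rewrite (mxdotC B A) -!frobnorm_sqr [X in 0 <= X](_ : _ = frobnorm B ^+ 2 *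
  (frobnorm A ^+ 2 * frobnorm B ^+ 2 - mxdot A B ^+ 2)); last by ring.
by rewrite pmulr_rge0 // subr_ge0.
Qed.

Lemma mxdot_le m n (A B : 'M[R]_(m, n)) :
  mxdot A B <= frobnorm A * frobnorm B.
Proof.
apply: le_trans (ler_norm _) _.
rewrite -(@ler_pXn2r _ 2) ?nnegrE ?mulr_ge0 ?frobnorm_ge0 //.
by rewrite real_normK ?num_real // exprMn mxdot_sqr_le.
Qed.

Lemma frobnormD m n (A B : 'M[R]_(m, n)) :
  frobnorm (A + B) <= frobnorm A + frobnorm B.
Proof.
rewrite -(@ler_pXn2r _ 2) ?nnegrE ?addr_ge0 ?frobnorm_ge0 //.
rewrite frobnorm_sqr !(mxdotDl, mxdotDr) (mxdotC B A) -!frobnorm_sqr sqrrD.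
have := mxdot_le A B; rewrite mulr2n; lra.
Qed.

Lemma frobnormB m n (A B : 'M[R]_(m, n)) :
  frobnorm (A - B) <= frobnorm A + frobnorm B.
Proof. by rewrite (le_trans (frobnormD _ _)) // frobnormN. Qed.

Lemma frobnormM m n p (A : 'M[R]_(m, n)) (B : 'M_(n, p)) :
  frobnorm (A *m B) <= frobnorm A * frobnorm B.
Proof.
rewrite -(@ler_pXn2r _ 2) ?nnegrE ?mulr_ge0 ?frobnorm_ge0 // exprMn.
rewrite -(frobnorm_tr A) !frobnorm_sqr !mxdotE mulr_sumr; apply: ler_sum => k _.
rewrite mulr_suml; apply: ler_sum => i _.
have := mxdot_sqr_le (row i A)^T (col k B).
rewrite !frobnorm_sqr !mxdotE !big_ord1 mxdot_sumE big_ord1.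
rewrite (_ : \sum_l _ = (A *m B) i k); last first.
  by rewrite mxE; apply: eq_bigr => l _; rewrite !mxE.
move/le_trans; apply; rewrite le_eqVlt; apply/orP; left; apply/eqP.
by congr (_ * _); apply: eq_bigr => l _; rewrite !mxE.
Qed.

Lemma frobnorm_semiorthM m n p (Y : 'M[R]_(m, n)) (A : 'M[R]_(n, p)) :
  Y^T *m Y = 1%:M -> frobnorm (Y *m A) = frobnorm A.
Proof. by move=> Y1; rewrite /frobnorm mxdot_mull mulmxA Y1 mul1mx. Qed.

(** [|Y^T A|^2 = <A, Y Y^T A> <= |A| |Y Y^T A| = |A| |Y^T A|], and one factor cancels. *)
Lemma frobnorm_trM_le m n p (Y : 'M[R]_(m, n)) (A : 'M[R]_(m, p)) :
  Y^T *m Y = 1%:M -> frobnorm (Y^T *m A) <= frobnorm A.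
Proof.
move=> Y1; have [A0|A0] := leP (frobnorm (Y^T *m A)) 0.
  exact: le_trans A0 (frobnorm_ge0 _).
rewrite -(ler_pM2l A0) -expr2 frobnorm_sqr mxdot_mull trmxK.
by rewrite mxdotC (le_trans (mxdot_le _ _)) // frobnorm_semiorthM.
Qed.

Lemma frobnorm_orthMr m n (A : 'M[R]_(m, n)) (U : 'M[R]_n) :
  U^T *m U = 1%:M -> frobnorm (A *m U) = frobnorm A.
Proof.
move=> /mulmx1C U1; rewrite -frobnorm_tr trmx_mul frobnorm_semiorthM ?trmxK //.
exact: frobnorm_tr.
Qed.

Lemma frobnorm_semiorth m n (Y : 'M[R]_(m, n)) :
  Y^T *m Y = 1%:M -> frobnorm Y ^+ 2 = n%:R.
Proof. by move=> Y1; rewrite frobnorm_sqr /mxdot Y1 mxtrace1. Qed.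

(** * Block structure of stacked configurations and of their Gram matrices *)

Lemma mxdot_row_mx m n1 n2 (A1 B1 : 'M[R]_(m, n1)) (A2 B2 : 'M[R]_(m, n2)) :
  mxdot (row_mx A1 A2) (row_mx B1 B2) = mxdot A1 B1 + mxdot A2 B2.
Proof.
rewrite /mxdot [LHS]mxtrace_mulC tr_row_mx mul_row_col linearD /=.
by rewrite !(mxtrace_mulC _ _^T).
Qed.

Lemma mxdot_stack d n r (Y Y' : 'I_n -> 'M[R]_(r, d)) (p p' : 'I_n -> 'cV[R]_r) :
  mxdot (stack Y p) (stack Y' p') =
  \sum_i (mxdot (Y i) (Y' i) + mxdot (p i) (p' i)).
Proof.
rewrite /mxdot [LHS]mxtrace_mulC tr_mxrow mul_mxrow_mxcol linear_sum /=.
apply: eq_bigr => i _.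
by rewrite -!/(mxdot _ _) -mxdot_row_mx /mxdot mxtrace_mulC.
Qed.

Lemma frobnorm_stack d n r (Y : 'I_n -> 'M[R]_(r, d)) (p : 'I_n -> 'cV[R]_r) :
  frobnorm (stack Y p) ^+ 2 =
  \sum_i (frobnorm (Y i) ^+ 2 + frobnorm (p i) ^+ 2).
Proof.
by rewrite frobnorm_sqr mxdot_stack; apply: eq_bigr => i _; rewrite !frobnorm_sqr.
Qed.

Lemma stackK d n r (X : 'M[R]_(r, pgdim d n)) :
  stack (fun i => X *m selY R d i) (fun i => X *m selp R d i) = X.
Proof.
rewrite [RHS]stack_surj; congr stack; apply/funext => i.
  by rewrite {1}(stack_surj X) stack_selY.
by rewrite {1}(stack_surj X) stack_selp.
Qed.

Lemma mulmx_stack d n r s (A : 'M[R]_(s, r)) (Y : 'I_n -> 'M[R]_(r, d))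
    (p : 'I_n -> 'cV[R]_r) :
  A *m stack Y p = stack (fun i => A *m Y i) (fun i => A *m p i).
Proof.
by rewrite /stack mul_mxrow; apply: eq_mxrow => i; rewrite mul_mx_row.
Qed.

(** Transposed selectors are themselves stacks, so [stack_selY] also computes products of two
    selectors. *)
Lemma selY_tr d n (i : 'I_n) :
  (selY R d i)^T = stack (fun k => if k == i then 1%:M else 0) (fun=> 0).
Proof.
rewrite /selY tr_mxcol; apply: eq_mxrow => k; case: eqP => _.
  by rewrite tr_col_mx trmx1 trmx0.
by rewrite trmx0 row_mx0.
Qed.

Lemma selp_tr d n (i : 'I_n) :
  (selp R d i)^T = stack (fun=> 0) (fun k => if k == i then 1%:M else 0).
Proof.
rewrite /selp tr_mxcol; apply: eq_mxrow => k; case: eqP => _.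
  by rewrite tr_col_mx trmx1 trmx0.
by rewrite trmx0 row_mx0.
Qed.

(** Turns the diagonal constraint of the semidefinite program into orthonormality of the columns of
    each [Y_i]. *)
Lemma gram_block d n r (X : 'M[R]_(r, pgdim d n)) i :
  ulsubmx (submxblock (X^T *m X) i i) =
  (X *m selY R d i)^T *m (X *m selY R d i) :> 'M_d.
Proof.
rewrite -{1 2}(stackK X) /stack tr_mxrow mul_mxcol_mxrow mxblockK.
by rewrite tr_row_mx mul_col_row block_mxKul.
Qed.

Lemma gram_first_rows d n r (X : 'M[R]_(r, pgdim d n.+1)) :
  first_rows (X^T *m X) = (X *m selY R d ord0)^T *m X.
Proof.
rewrite /first_rows -{1}(stackK X) /stack tr_mxrow mxcol_mul mxcolK.
by rewrite tr_row_mx mul_col_mx col_mxKu.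
Qed.

End Frobenius.

(** * Spectral norm, determinants and Gram factorizations *)

(** Each column is the image of a unit vector, so [|A|^2] is at most [n] times the squared spectral
    norm; the cruder constant [n^2] avoids a square root. *)
Lemma frobnorm_le_specnorm (R : realType) m n (A : 'M[R]_(m, n)) :
  frobnorm A <= n%:R * specnorm A.
Proof.
have ubA := sup_upper_bound (specnorm_has_sup A).
have s0 : 0 <= specnorm A.
  apply: le_trans (ubA (frobnorm (A *m 0)) _); first exact: frobnorm_ge0.
  by exists 0 => //=; rewrite frobnorm0 ler01.
have colA j : frobnorm (col j A) <= specnorm A.
  apply: ubA; exists (delta_mx j 0); last by rewrite colE.
  rewrite /= /frobnorm mxdotE big_ord1 (bigD1 j) //= big1 => [|i /negPf ij].
    by rewrite mxE !eqxx expr1n addr0 sqrtr1.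
  by rewrite mxE ij expr0n.
rewrite -(@ler_pXn2r _ 2) ?nnegrE ?mulr_ge0 ?frobnorm_ge0 // exprMn.
rewrite frobnorm_sqr mxdotE.
apply: (@le_trans _ _ (\sum_(j < n) specnorm A ^+ 2)).
  apply: ler_sum => j _; rewrite (_ : \sum_i _ = frobnorm (col j A) ^+ 2).
    by rewrite lerXn2r // nnegrE frobnorm_ge0.
  by rewrite frobnorm_sqr mxdotE big_ord1; apply: eq_bigr => i _; rewrite mxE.
rewrite sumr_const card_ord -[leLHS]mulr_natl ler_wpM2r ?sqr_ge0 //.
by rewrite -natrX ler_nat; case: (n) => // k; rewrite leq_pmulr.
Qed.

(** If [\det O = -1], then [\det (O + 1) = - \det (O + 1)] vanishes, so [O] has eigenvalue [-1].
    There [O - 1] acts as [-2], which forces [|O - 1| >= 2]. *)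
Lemma orth_near1_det (R : realType) d (O : 'M[R]_d) :
  O^T *m O = 1%:M -> frobnorm (O - 1%:M) ^+ 2 < 4%:R -> \det O = 1.
Proof.
move=> O1; apply: contraTeq => detO; rewrite -leNgt.
have detO1 : \det O = -1.
  have : \det O ^+ 2 = 1 by rewrite expr2 -{1}det_tr -det_mulmx O1 det1.
  by move/eqP; rewrite sqrf_eq1 (negPf detO) /= => /eqP.
have : \det (O + 1%:M) == 0.
  have : \det (O + 1%:M) = - \det (O + 1%:M).
    rewrite -[in RHS]det_tr linearD /= trmx1 -mulN1r -detO1 -det_mulmx.
    by rewrite mulmxDr mulmx1 (mulmx1C O1) addrC.
  by move=> h; apply/eqP; lra.
case/det0P => x x0; rewrite mulmxDr mulmx1 => /eqP.
rewrite addr_eq0 => /eqP xO.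
have xO2 : x *m (O - 1%:M) = (- 2%:R) *: x.
  by rewrite mulmxBr mulmx1 xO scaleNr scaler_nat mulr2n opprD.
have x2 : 0 < frobnorm x ^+ 2.
  by rewrite ltNge; apply: contra x0 => /frobnorm0_eq0 ->.
have := frobnormM x (O - 1%:M); rewrite xO2.
rewrite -(@ler_pXn2r _ 2) ?nnegrE ?mulr_ge0 ?frobnorm_ge0 // exprMn.
rewrite [leLHS]frobnorm_sqr mxdotZl mxdotZr -frobnorm_sqr mulrA mulrC.
by rewrite ler_pM2l // mulrNN -natrM.
Qed.

(* Cholesky: a zero pivot [a] forces a zero column, and then [a^-1 = 0] and
   [Num.sqrt a = 0] make the generic formulas valid. *)
Lemma psd_gram (R : realType) m (Z : 'M[R]_m) :
  psd Z -> exists X : 'M[R]_m, Z = X^T *m X.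
Proof.
elim: m Z => [|m IHm] Z [Zs Zp]; first by exists 0; rewrite [LHS]flatmx0 [RHS]flatmx0.
rewrite -[m.+1]/(1 + m)%N in Z Zs Zp *.
pose a := ulsubmx Z 0 0; pose b := dlsubmx Z; pose C := drsubmx Z.
have ZE : Z = block_mx a%:M b^T b C.
  rewrite -[LHS]submxK /a -mx11_scalar; congr block_mx.
  by rewrite /b trmx_dlsub Zs.
have trb (y : 'cV_m) : y^T *m b = b^T *m y.
  by rewrite [RHS]mx11_scalar -tr_scalar_mx -mx11_scalar trmx_mul trmxK.
have Cs : C^T = C by rewrite /C trmx_drsub Zs.
have quad u (y : 'cV_m) :
    0 <= a * u ^+ 2 + 2%:R * u * (b^T *m y) 0 0 + (y^T *m C *m y) 0 0.
  have := Zp (col_mx u%:M y); rewrite {1}ZE tr_col_mx mul_row_block mul_row_col.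
  rewrite trb mulmxDl mulmxDl tr_scalar_mx -!scalar_mxM !mul_scalar_mx.
  rewrite mul_mx_scalar -scalemxAl !mxE eqxx mulr1n => /le_trans; apply.
  rewrite le_eqVlt; apply/orP; left; apply/eqP.
  by ring.
have a0 : 0 <= a.
  by have := quad 1 0; rewrite !mulmx0 !mxE; lra.
have sE k (v : 'M[R]_1) : (k *: v) 0 0 = k * v 0 0 by rewrite mxE.
have bE (v w : 'M[R]_1) : (v - w) 0 0 = v 0 0 - w 0 0 by rewrite !mxE.
have b0 : a = 0 -> b = 0.
  move=> a00; suff /eqP : 2%:R * mxdot b b = 0.
    rewrite mulf_eq0 pnatr_eq0 /= -frobnorm_sqr => /eqP bb.
    by apply: frobnorm0_eq0; rewrite bb.
  apply: (@quad_ge0_linear0 _ _ (mxdot b (C *m b))) => s.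
  have := quad 1 (s *: b); rewrite a00 [(_ *: _)^T]linearZ /= -!scalemxAr.
  rewrite -!scalemxAl -mulmxA !sE -(trace_mx11 (b^T *m b)).
  rewrite -(trace_mx11 (b^T *m (C *m b))) -!/(mxdot _ _).
  by move/le_trans; apply; rewrite le_eqVlt; apply/orP; left; apply/eqP; ring.
have aV : a * a^-1 ^+ 2 = a^-1.
  have [->|an0] := eqVneq a 0; first by rewrite invr0 mul0r.
  by rewrite expr2 mulrA divff ?mul1r.
have [|X XE] := IHm (C - a^-1 *: (b *m b^T)).
  split; first by rewrite linearB /= [(_ *: _)^T]linearZ /= trmx_mul trmxK Cs.
  (* For [a > 0] this value of [u] minimizes the form in [u]; what remains is the Schur complement
     at [y]. *)
  move=> y; have := quad (- (a^-1 * (b^T *m y) 0 0)) y.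
  rewrite mulmxBr mulmxBl -scalemxAr -scalemxAl mulmxA -(mulmxA (y^T *m b)).
  rewrite trb {5}[b^T *m y]mx11_scalar mul_mx_scalar.
  rewrite bE !sE.
  rewrite [_ ^+ 2]sqrrN exprMn [a * _]mulrA aV.
  by move/le_trans; apply; rewrite le_eqVlt; apply/orP; left; apply/eqP; ring.
exists (block_mx (Num.sqrt a)%:M ((Num.sqrt a)^-1 *: b^T) 0 X).
rewrite tr_block_mx mulmx_block !tr_scalar_mx !trmx0 !mul0mx !mulmx0 !addr0 -XE.
rewrite -scalar_mxM -expr2 sqr_sqrtr // [(_ *: _)^T]linearZ /= trmxK.
rewrite mul_scalar_mx mul_mx_scalar !scalerA.
rewrite -scalemxAl -scalemxAr scalerA -invfM -expr2 sqr_sqrtr // addrC subrK.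
have [a00|an0] := eqVneq a 0; first by rewrite {1}ZE b0 // trmx0 !scaler0.
by rewrite divff ?mulVf ?sqrtr_eq0 -?ltNge ?lt0r ?an0 // !scale1r.
Qed.

(** * The pose-graph cost and its coercivity *)

Section Cost.
Variables (R : realType) (d n : nat) (E : rel 'I_n.+1).
Variables (kappa tau : 'I_n.+1 -> 'I_n.+1 -> R).
Hypotheses (kappa_gt0 : forall i j, E i j -> 0 < kappa i j)
  (tau_gt0 : forall i j, E i j -> 0 < tau i j).

Lemma pgo_cost_ge0 Rm tm r (Y : 'I_n.+1 -> 'M[R]_(r, d)) p :
  0 <= pgo_cost E kappa tau Rm tm Y p.
Proof.
apply: sumr_ge0 => i _; apply: sumr_ge0 => j Eij.
by rewrite addr_ge0 // mulr_ge0 ?sqr_ge0 // ltW ?kappa_gt0 ?tau_gt0.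
Qed.

(** Each edge term is at most the whole sum. Taking square roots makes the bounds linear, so that
    the triangle inequality can chain them along a path. *)
Lemma pgo_cost_edge Rm tm r (Y : 'I_n.+1 -> 'M[R]_(r, d)) p i j :
  E i j ->
  frobnorm (Y j - Y i *m Rm i j) <=
    Num.sqrt (kappa i j)^-1 * Num.sqrt (pgo_cost E kappa tau Rm tm Y p) /\
  frobnorm (p j - p i - Y i *m tm i j) <=
    Num.sqrt (tau i j)^-1 * Num.sqrt (pgo_cost E kappa tau Rm tm Y p).
Proof.
move=> Eij; have k0 := kappa_gt0 Eij; have t0 := tau_gt0 Eij.
set c := pgo_cost _ _ _ _ _ _ _; set A := _ - _ *m _; set b := _ - _ *m tm i j.
have : kappa i j * frobnorm A ^+ 2 + tau i j * frobnorm b ^+ 2 <= c.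
  have nn k l : E k l -> 0 <= kappa k l * frobnorm (Y l - Y k *m Rm k l) ^+ 2 +
     tau k l * frobnorm (p l - p k - Y k *m tm k l) ^+ 2.
    move=> Ekl; rewrite addr_ge0 // mulr_ge0 ?sqr_ge0 //.
      by rewrite ltW ?kappa_gt0.
    by rewrite ltW ?tau_gt0.
  rewrite /c /pgo_cost (bigD1 i) //= (bigD1 j) //= -addrA lerDl addr_ge0 //.
    by apply: sumr_ge0 => l /andP[El _]; apply: nn.
  by apply: sumr_ge0 => k _; apply: sumr_ge0 => l; apply: nn.
have kA : 0 <= kappa i j * frobnorm A ^+ 2 by rewrite mulr_ge0 ?sqr_ge0 // ltW.
have tb : 0 <= tau i j * frobnorm b ^+ 2 by rewrite mulr_ge0 ?sqr_ge0 // ltW.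
move=> le_c; split; rewrite [leLHS]/frobnorm -sqrtrM ?invr_ge0
  ?(ltW k0) ?(ltW t0) // ler_wsqrtr //.
  by rewrite ler_pdivlMl // -frobnorm_sqr; lra.
by rewrite ler_pdivlMl // -frobnorm_sqr; lra.
Qed.

Lemma pgo_cost_mull Rm tm r s (A : 'M[R]_(r, s)) (Y : 'I_n.+1 -> 'M[R]_(r, d)) p :
  A^T *m A = 1%:M ->
  pgo_cost E kappa tau Rm tm (fun i => A^T *m Y i) (fun i => A^T *m p i) <=
  pgo_cost E kappa tau Rm tm Y p.
Proof.
move=> A1; apply: ler_sum => i _; apply: ler_sum => j Eij.
rewrite -!mulmxA -!mulmxBr.
by apply: lerD; rewrite ler_pM2l ?kappa_gt0 ?tau_gt0 // lerXn2r ?nnegrE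
  ?frobnorm_ge0 //; apply: frobnorm_trM_le.
Qed.

Lemma pgo_cost_shift Rm tm r (Y : 'I_n.+1 -> 'M[R]_(r, d)) p c :
  pgo_cost E kappa tau Rm tm Y (fun i => p i - c) =
  pgo_cost E kappa tau Rm tm Y p.
Proof.
apply: eq_bigr => i _; apply: eq_bigr => j _.
by rewrite opprB addrA subrK.
Qed.

Variables (R0 : 'I_n.+1 -> 'M[R]_d) (t0 : 'I_n.+1 -> 'cV[R]_d).
Hypothesis (R0_orth : forall i, (R0 i)^T *m R0 i = 1%:M).

Let cost0 r (Y : 'I_n.+1 -> 'M[R]_(r, d)) p :=
  pgo_cost E kappa tau (fun i j => (R0 i)^T *m R0 j)
    (fun i j => (R0 i)^T *m (t0 j - t0 i)) Y p.

Lemma pgo_cost_true : cost0 R0 t0 = 0.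
Proof.
apply: big1 => i _; apply: big1 => j _.
rewrite !mulmxA (mulmx1C (R0_orth i)) !mul1mx !subrr !frobnorm0 expr0n.
by rewrite !mulr0 addr0.
Qed.

Let frobnorm_R0tr r (A : 'M[R]_(r, d)) i : frobnorm (A *m (R0 i)^T) = frobnorm A.
Proof. by rewrite frobnorm_orthMr // trmxK (mulmx1C (R0_orth i)). Qed.

(** The constant depends on the edge alone, not on [r], [Y] or [p]. The translation bound comes in
    two forms, relative to either endpoint, because a path may traverse the edge in either
    direction. *)
Let edge_bound i j : E i j -> exists2 c : R, 0 <= c &
  forall r (Y : 'I_n.+1 -> 'M[R]_(r, d)) p,
  let s := Num.sqrt (cost0 Y p) in
  [/\ frobnorm (Y j *m (R0 j)^T - Y i *m (R0 i)^T) <= c * s,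
      frobnorm (p j - p i) <= c * (s + frobnorm (Y i)) &
      frobnorm (p j - p i) <= c * (s + frobnorm (Y j))].
Proof.
move=> Eij; set T := frobnorm (t0 j - t0 i).
have T0 : 0 <= T := frobnorm_ge0 _.
pose k := Num.sqrt (kappa i j)^-1; pose l := Num.sqrt (tau i j)^-1.
have k0 : 0 <= k := sqrtr_ge0 _; have l0 : 0 <= l := sqrtr_ge0 _.
(* [k] and [l] bound the two residuals and [T] the term [Y_i t_ij]; [T * k] appears when [|Y_i|] is
   replaced by [|Y_j| + k s]. *)
exists (k + l + T + T * k) => [|r Y p s]; first by rewrite !addr_ge0 ?mulr_ge0.
have s0 : 0 <= s := sqrtr_ge0 _.
have [] := @pgo_cost_edge (fun i j => (R0 i)^T *m R0 j)
  (fun i j => (R0 i)^T *m (t0 j - t0 i)) r Y p i j Eij.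
rewrite -/(cost0 Y p) -/s -/k -/l !mulmxA => hY hp.
(* Multiplying the rotation residual on the right by the orthogonal [(R0 j)^T] keeps its norm. *)
have hY' : frobnorm (Y j *m (R0 j)^T - Y i *m (R0 i)^T) <= k * s.
  apply: le_trans hY; rewrite -[leRHS](@frobnorm_orthMr _ _ _ _ (R0 j)^T).
    by rewrite mulmxBl -!mulmxA (mulmx1C (R0_orth j)) mulmx1.
  by rewrite trmxK (mulmx1C (R0_orth j)).
have Yij : frobnorm (Y i) <= frobnorm (Y j) + k * s.
  rewrite -(frobnorm_R0tr (Y i) i) -(frobnorm_R0tr (Y j) j)
    -[X in frobnorm X](subKr (Y j *m (R0 j)^T)).
  by apply: (le_trans (frobnormB _ _)); rewrite lerD2l.
have pij : frobnorm (p j - p i) <= l * s + frobnorm (Y i) * T.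
  rewrite -[X in frobnorm X](subrK (Y i *m (R0 i)^T *m (t0 j - t0 i))).
  apply: (le_trans (frobnormD _ _)); rewrite lerD //.
  by apply: (le_trans (frobnormM _ _)); rewrite frobnorm_R0tr.
have Yi0 := frobnorm_ge0 (Y i); have Yj0 := frobnorm_ge0 (Y j).
have ks := mulr_ge0 k0 s0; have ls := mulr_ge0 l0 s0; have Ts := mulr_ge0 T0 s0.
have Tk := mulr_ge0 T0 k0; have Tks := mulr_ge0 Tk s0.
have aux y : 0 <= y -> 0 <= k * y /\ 0 <= l * y /\ 0 <= T * y /\ 0 <= T * k * y.
  by move=> y0; rewrite !mulr_ge0.
have [? [? [? ?]]] := aux _ Yi0; have [? [? [? ?]]] := aux _ Yj0.
have := ler_wpM2r T0 Yij.
by split; rewrite ?mulrDr ?mulrDl; lra.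
Qed.

Hypothesis Econn : weakly_connected E.

(** Induction on an undirected path from the root [ord0], adding its last edge at each step. *)
Let vertex_bound v : exists2 c : R, 0 <= c &
  forall r (Y : 'I_n.+1 -> 'M[R]_(r, d)) p,
  let s := Num.sqrt (cost0 Y p) in
  frobnorm (Y v *m (R0 v)^T - Y ord0 *m (R0 ord0)^T) <= c * s /\
  frobnorm (p v - p ord0) <= c * (s + frobnorm (Y ord0)).
Proof.
have /connectP[q] := Econn ord0 v.
elim/last_ind: q v => [|q w IHq] v.
  move=> _ ->; exists 0 => // r Y p s; split.
    by rewrite subrr frobnorm0 mul0r.
  by rewrite subrr frobnorm0 mul0r.
rewrite last_rcons rcons_path => /andP[pq uw] ->.
have [c c0 hc] := IHq _ pq erefl; set u := last _ _ in uw hc.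
have [b b0 hb] : exists2 b : R, 0 <= b &
    forall r (Y : 'I_n.+1 -> 'M[R]_(r, d)) p,
    let s := Num.sqrt (cost0 Y p) in
    frobnorm (Y w *m (R0 w)^T - Y u *m (R0 u)^T) <= b * s /\
    frobnorm (p w - p u) <= b * (s + frobnorm (Y u)).
  case/orP: uw => /edge_bound[b b0 hb]; exists b => // r Y p s.
    by have [] := hb r Y p.
  by have [? _ ?] := hb r Y p; split; rewrite frobnormC.
(* The product [b * c] comes from bounding [|Y_u|] by [c s + |Y_0|] in the translation bound of the
   last edge. *)
exists (c + b + b * c) => [|r Y p s]; first by rewrite !addr_ge0 ?mulr_ge0.
have [hc1 hc2] := hc r Y p; have [hb1 hb2] := hb r Y p.
rewrite -/s in hc1 hc2 hb1 hb2.
have Yu : frobnorm (Y u) <= c * s + frobnorm (Y ord0).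
  rewrite -(frobnorm_R0tr (Y u) u) -(frobnorm_R0tr (Y ord0) ord0)
    -[X in frobnorm X <= _](subrK (Y ord0 *m (R0 ord0)^T)).
  by apply: (le_trans (frobnormD _ _)); rewrite lerD2r.
have s0 : 0 <= s := sqrtr_ge0 _; have y0 := frobnorm_ge0 (Y ord0).
have bcs := mulr_ge0 (mulr_ge0 b0 c0) s0.
have bcy := mulr_ge0 (mulr_ge0 b0 c0) y0.
have bYu := ler_wpM2l b0 Yu.
split.
  rewrite -[X in frobnorm X](subrKA (Y u *m (R0 u)^T)).
  by apply: (le_trans (frobnormD _ _)); lra.
rewrite -[X in frobnorm X](subrKA (p u)).
by apply: (le_trans (frobnormD _ _)); lra.
Qed.

Lemma pgo_cost_coercive : exists2 K : R, 0 < K &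
  forall r (Y : 'I_n.+1 -> 'M[R]_(r, d)) p,
  (forall i, frobnorm (Y i *m (R0 i)^T - Y ord0 *m (R0 ord0)^T) ^+ 2
     <= K * cost0 Y p) /\
  (p ord0 = 0 ->
   frobnorm (stack Y p) ^+ 2 <= K * (frobnorm (Y ord0) ^+ 2 + cost0 Y p)).
Proof.
have /choice[c hc] : forall v, exists c : R, 0 <= c /\
  forall r (Y : 'I_n.+1 -> 'M[R]_(r, d)) p,
  let s := Num.sqrt (cost0 Y p) in
  frobnorm (Y v *m (R0 v)^T - Y ord0 *m (R0 ord0)^T) <= c * s /\
  frobnorm (p v - p ord0) <= c * (s + frobnorm (Y ord0)).
  by move=> v; have [c c0 hc] := vertex_bound v; exists c.
pose C := \sum_v c v.
have C0 : 0 <= C by apply: sumr_ge0 => v _; case: (hc v).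
have cC v : c v <= C.
  rewrite /C (bigD1 v) //= lerDl; apply: sumr_ge0 => w _; by case: (hc w).
(* [K1] serves the contribution of one vertex to the squared norm; the factor [n.+1] below sums over
   the vertices. *)
pose K1 := 2%:R + 4%:R * C ^+ 2.
have K10 : 0 < K1 by rewrite ltr_pwDl ?mulr_ge0 ?sqr_ge0.
exists (n.+1%:R * K1) => [|r Y p]; first by rewrite mulr_gt0.
set s := Num.sqrt (cost0 Y p).
have s0 : 0 <= s := sqrtr_ge0 _.
have ss : s ^+ 2 = cost0 Y p by rewrite sqr_sqrtr // pgo_cost_ge0.
have y0 := frobnorm_ge0 (Y ord0).
have hC v : frobnorm (Y v *m (R0 v)^T - Y ord0 *m (R0 ord0)^T) <= C * s /\
    frobnorm (p v - p ord0) <= C * (s + frobnorm (Y ord0)).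
  have [_ /(_ r Y p)[h1 h2]] := hc v; split.
    by apply: (le_trans h1); rewrite ler_wpM2r.
  by apply: (le_trans h2); rewrite ler_wpM2r // addr_ge0.
have n1 : 1 <= n.+1%:R :> R by rewrite ler1n.
rewrite -ss; split=> [i|p0].
  apply: (@le_trans _ _ ((C * s) ^+ 2)).
    by rewrite lerXn2r ?nnegrE ?mulr_ge0 ?frobnorm_ge0 //; case: (hC i).
  rewrite exprMn ler_wpM2r ?sqr_ge0 //; have C20 := sqr_ge0 C.
  apply: (@le_trans _ _ K1); first by rewrite /K1; lra.
  by rewrite ler_peMl // ltW.
rewrite frobnorm_stack -mulrA mulr_natl -[X in _ *+ X]card_ord -sumr_const.
apply: ler_sum => i _; have [h1 h2] := hC i; rewrite p0 subr0 in h2.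
have h3 : frobnorm (Y i) <= C * s + frobnorm (Y ord0).
  rewrite -(frobnorm_R0tr (Y i) i) -(frobnorm_R0tr (Y ord0) ord0)
    -[X in frobnorm X <= _](subrK (Y ord0 *m (R0 ord0)^T)).
  by apply: (le_trans (frobnormD _ _)); rewrite lerD2r.
apply: (@le_trans _ _ ((C * s + frobnorm (Y ord0)) ^+ 2 +
                       (C * (s + frobnorm (Y ord0))) ^+ 2)).
  by rewrite lerD // lerXn2r ?nnegrE ?frobnorm_ge0 ?addr_ge0 ?mulr_ge0 ?addr_ge0.
rewrite /K1 -subr_ge0.
set y := frobnorm (Y ord0).
(* The parallelogram law, applied to both squares, writes the difference as a sum of squares. *)
rewrite (_ : _ - _ = (C * s - y) ^+ 2 + (C * (s - y)) ^+ 2 +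
  2%:R * s ^+ 2 + 2%:R * (C * y) ^+ 2); last by ring.
by rewrite !addr_ge0 ?sqr_ge0 // mulr_ge0 ?sqr_ge0.
Qed.

End Cost.

(** * First-order optimality conditions and quadratic-form estimates *)

Lemma selp_selY (R : realType) d n (i j : 'I_n) :
  (selp R d i)^T *m selY R d j = 0.
Proof. by rewrite selp_tr stack_selY. Qed.

Lemma selY_selY (R : realType) d n (i j : 'I_n) :
  (selY R d i)^T *m selY R d j = if j == i then 1%:M else 0.
Proof. by rewrite selY_tr stack_selY. Qed.

Lemma mxdot_delta (R : realType) m n (a : 'I_m) (b : 'I_n) (M : 'M[R]_(m, n)) :
  mxdot (delta_mx a b) M = M a b.
Proof.
rewrite mxdot_sumE (bigD1 b) //= (bigD1 a) //= mxE !eqxx mul1r.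
rewrite !big1 ?addr0 // => [j /negPf jb|i /negPf ia].
  by apply: big1 => i _; rewrite mxE jb andbF mul0r.
by rewrite mxE ia mul0r.
Qed.

(** The matrices [E_ab - E_ba] already detect every asymmetry, and they satisfy [J^3 = - J].
    Restricting to such [J] gives the rotations they generate a closed rational form. *)
Lemma symmetric_of_skew_orthogonal (R : realType) r (M : 'M[R]_r) :
  (forall J : 'M[R]_r, J^T = - J -> J *m J *m J = - J -> mxdot J M = 0) ->
  M^T = M.
Proof.
move=> hM; apply/matrixP => b a; rewrite mxE.
have [->//|ab] := eqVneq a b.
apply/eqP; rewrite -subr_eq0 -!mxdot_delta -mxdotBl; apply/eqP/hM.
  by rewrite linearB /= !trmx_delta opprB.
have ba : b != a by rewrite eq_sym.
rewrite !(mulmxBl, mulmxBr).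
rewrite !(mul_delta_mx_cond, eqxx, negPf ab, negPf ba, mulr0n, mulr1n, mul0mx).
by rewrite !(mul0mx, subr0, sub0r, opprK) opprB addrC.
Qed.

Lemma mxdot_gramE (R : realType) r N (Q : 'M[R]_N) (X : 'M[R]_(r, N)) :
  Q^T = Q -> mxdot Q (X^T *m X) = mxdot (X *m Q) X.
Proof. by move=> Qs; rewrite mxdotC mxdot_mull trmxK mxdotC. Qed.

Lemma mxdot_gramD (R : realType) r N (Q : 'M[R]_N) (X D : 'M[R]_(r, N)) :
  Q^T = Q ->
  mxdot Q ((X + D)^T *m (X + D)) =
  mxdot Q (X^T *m X) + 2%:R * mxdot (X *m Q) D + mxdot Q (D^T *m D).
Proof.
move=> Qs; rewrite !mxdot_gramE // mulmxDl !(mxdotDl, mxdotDr).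
have -> : mxdot (D *m Q) X = mxdot (X *m Q) D by rewrite mxdot_mulr Qs mxdotC.
ring.
Qed.

Lemma mxdot_stackK (R : realType) d n r (A B : 'M[R]_(r, pgdim d n)) :
  mxdot A B = \sum_i (mxdot (A *m selY R d i) (B *m selY R d i) +
                      mxdot (A *m selp R d i) (B *m selp R d i)).
Proof. by rewrite -{1}(stackK A) -{1}(stackK B) mxdot_stack. Qed.

Section FirstOrder.
Variables (R : realType) (d n r : nat).
Implicit Type X : 'M[R]_(r, pgdim d n).
Variables (Q : 'M[R]_(pgdim d n)) (X : 'M[R]_(r, pgdim d n)).
Hypothesis Qsym : Q^T = Q.

Let feasible X' := forall i, (X' *m selY R d i)^T *m (X' *m selY R d i) = 1%:M.

Hypotheses (Xfeas : feasible X) (Xmin : forall X', feasible X' ->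
  mxdot Q (X^T *m X) <= mxdot Q (X'^T *m X')).

(** The constraints do not involve [p_i], so it can move along its own gradient block [g]; the
    linear coefficient of the increment is then [2 |g|^2]. *)
Lemma critical_translation i : X *m Q *m selp R d i = 0.
Proof.
set g := _ *m _; apply: frobnorm0_eq0; rewrite frobnorm_sqr.
pose D := g *m (selp R d i)^T.
suff /eqP : 2%:R * mxdot g g = 0 by rewrite mulf_eq0 pnatr_eq0 /= => /eqP ->.
apply: (@quad_ge0_linear0 _ _ (mxdot Q (D^T *m D))) => s.
have /Xmin : feasible (X + s *: D).
  by move=> j; rewrite mulmxDl -scalemxAl -mulmxA selp_selY mulmx0 scaler0 addr0.
rewrite mxdot_gramD // -addrA lerDl mxdotZr [(_ *: _)^T]linearZ /=.
have -> : mxdot (X *m Q) D = mxdot g g.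
  by rewrite /D [LHS]mxdotC [LHS]mxdot_mulr trmxK.
rewrite -scalemxAl -scalemxAr !mxdotZr.
by move/le_trans; apply; rewrite le_eqVlt; apply/orP; left; apply/eqP; ring.
Qed.

(* [1 + w (t J + t^2 J^2)], with [w = 2 / (1 + t^2)], is a rational
   parametrization of the rotations generated by [J]. *)
Lemma critical_rotation i :
  X *m Q *m selY R d i =
  X *m selY R d i *m ((X *m Q *m selY R d i)^T *m (X *m selY R d i)).
Proof.
set Y := X *m selY R d i; set G := X *m Q *m _.
(* Symmetry suffices: [Y G^T Y = G Y^T Y = G], by feasibility. *)
suff Msym : (G *m Y^T)^T = G *m Y^T.
  rewrite mulmxA; have -> : Y *m G^T = G *m Y^T.
    by rewrite -[RHS]Msym [RHS]trmx_mul trmxK.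
  by rewrite -mulmxA Xfeas mulmx1.
apply: symmetric_of_skew_orthogonal => J JT J3.
rewrite -[_ *m Y^T]/(G *m Y^T) -mxdot_mulr.
pose D0 := J *m Y *m (selY R d i)^T.
(* The increment of the objective along the curve is [2 w] times a quadratic polynomial in [t]
   without constant term. This is the coefficient of [t^2] in it. *)
apply: (@quad_ge0_linear0 _ _
  (mxdot (J *m J *m Y) G + mxdot Q (D0^T *m D0))) => t.
have t1 : 0 < 1 + t ^+ 2 by rewrite ltr_pwDl ?sqr_ge0.
pose w := 2%:R / (1 + t ^+ 2).
have w0 : 0 < w by rewrite divr_gt0.
have wt : w * (1 + t ^+ 2) = 2%:R by rewrite mulfVK // gt_eqF.
pose F := w *: (t *: J + t ^+ 2 *: (J *m J)).
have FT : F^T = w *: (- t *: J + t ^+ 2 *: (J *m J)).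
  rewrite [LHS]linearZ /= linearD /= ![(_ *: _)^T]linearZ /= trmx_mul JT.
  by rewrite mulNmx mulmxN opprK scalerN scaleNr.
have J3' : J *m (J *m J) = - J by rewrite mulmxA.
have J4 : J *m J *m (J *m J) = - (J *m J) by rewrite -mulmxA J3' mulmxN.
(* The cubic terms cancel and [J^4 = - J^2]. As [w (1 + t^2) = 2], this product cancels
   [F + F^T = 2 w t^2 J^2], so [1 + F] is orthogonal. *)
have F2 : F^T *m F = (w ^+ 2 * t ^+ 2 * (1 + t ^+ 2)) *: (J^T *m J).
  rewrite FT /F JT mulNmx -scalemxAl -scalemxAr mulmxDl !mulmxDr.
  rewrite -!scalemxAl -!scalemxAr J4 J3 J3'.
  move: (J *m J) => K; apply/matrixP => x y; rewrite !mxE; ring.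
have F1 : (1%:M + F)^T *m (1%:M + F) = 1%:M.
  rewrite [(_ + _)^T]linearD /= trmx1 mulmxDl mul1mx mulmxDr mulmx1 F2.
  rewrite (_ : _ * _ * _ = 2%:R * w * t ^+ 2); last by rewrite -wt; ring.
  rewrite FT /F JT mulNmx.
  move: (J *m J) => K; apply/matrixP => x y; rewrite !mxE; ring.
pose D := F *m Y *m (selY R d i)^T.
have /Xmin : feasible (X + D).
  move=> j; rewrite mulmxDl /D -mulmxA selY_selY.
  case: eqP => [->|_]; last by rewrite mulmx0 addr0.
  rewrite mulmx1 -/Y -[X in X + _]mul1mx -mulmxDl trmx_mul mulmxA.
  by rewrite -(mulmxA Y^T) F1 mulmx1 Xfeas.
rewrite mxdot_gramD // -addrA lerDl.
have -> : mxdot (X *m Q) D =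
    w * (t * mxdot (J *m Y) G + t ^+ 2 * mxdot (J *m J *m Y) G).
  rewrite /D [LHS]mxdotC [LHS]mxdot_mulr trmxK -/G /F -scalemxAl mxdotZl mulmxDl mxdotDl.
  by rewrite -!scalemxAl !mxdotZl.
have -> : D^T *m D = (w ^+ 2 * t ^+ 2 * (1 + t ^+ 2)) *: (D0^T *m D0).
  rewrite /D /D0 -!(mulmxA _ Y) !trmx_mul !mulmxA -(mulmxA _ F^T) F2.
  by rewrite -scalemxAr -!scalemxAl !mulmxA.
rewrite mxdotZr.
rewrite (_ : w ^+ 2 * _ * _ = 2%:R * w * t ^+ 2); last by rewrite -wt; ring.
set g1 := mxdot _ G; set g2 := mxdot _ G; set m := mxdot Q _.
rewrite (_ : _ + _ = 2%:R * w * (g1 * t + (g2 + m) * t ^+ 2)); last by ring.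
by rewrite pmulr_rge0 // mulr_gt0.
Qed.

End FirstOrder.

(** The relation [X Q = X Lambda] survives left multiplication by [A]. Blockwise, translations then
    contribute nothing and a block [V = A Y_i] contributes [<V L_i, V> <= |L_i| |V|^2]. *)
Lemma critical_quad_le (R : realType) d n r s (Q : 'M[R]_(pgdim d n))
    (X : 'M[R]_(r, pgdim d n)) (L : 'I_n -> 'M[R]_d) (lambda : R)
    (A : 'M[R]_(s, r)) :
  Q^T = Q -> (forall i, X *m Q *m selp R d i = 0) ->
  (forall i, X *m Q *m selY R d i = X *m selY R d i *m L i) ->
  (forall i, frobnorm (L i) <= lambda) ->
  mxdot Q ((A *m X)^T *m (A *m X)) <= lambda * frobnorm (A *m X) ^+ 2.
Proof.
move=> Qs hp hY hL; rewrite mxdot_gramE // frobnorm_sqr !mxdot_stackK mulr_sumr.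
apply: ler_sum => i _; rewrite -!mulmxA !(mulmxA X) hp hY mulmx0 mxdot0l addr0.
set V := A *m (X *m _); rewrite !mulmxA -(mulmxA A) -/V.
have l0 := le_trans (frobnorm_ge0 _) (hL i).
apply: (le_trans (mxdot_le _ _)); rewrite mulrDr -[leLHS]addr0 lerD //; last first.
  by rewrite mulr_ge0 // mxdot_ge0.
rewrite -frobnorm_sqr expr2 mulrA ler_wpM2r ?frobnorm_ge0 //.
by apply: (le_trans (frobnormM _ _)); rewrite mulrC ler_wpM2r ?frobnorm_ge0.
Qed.

Lemma mxdot_gram_le (R : realType) r N (Q : 'M[R]_N) (X : 'M[R]_(r, N)) :
  mxdot Q (X^T *m X) <= frobnorm Q * frobnorm X ^+ 2.
Proof.
apply: (le_trans (mxdot_le _ _)); rewrite ler_wpM2l ?frobnorm_ge0 //.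
by rewrite expr2 -{1}(frobnorm_tr X) frobnormM.
Qed.

Lemma frobnorm_selY_le (R : realType) d n r (A : 'M[R]_(r, pgdim d n)) i :
  frobnorm (A *m selY R d i) <= frobnorm A.
Proof.
rewrite -(@ler_pXn2r _ 2) ?nnegrE ?frobnorm_ge0 // -{2}(stackK A) frobnorm_stack.
rewrite [leRHS](bigD1 i) //= -addrA lerDl addr_ge0 ?sqr_ge0 //.
by apply: sumr_ge0 => j _; rewrite addr_ge0 ?sqr_ge0.
Qed.

(* Expand [0 <= <Q, (X - s X Q)^T (X - s X Q)>] at [s = (1 + |Q|)^-1]. *)
Lemma frobnorm_mulmx_psd_le (R : realType) r N (Q : 'M[R]_N) (X : 'M[R]_(r, N)) :
  Q^T = Q -> (forall X' : 'M[R]_(r, N), 0 <= mxdot Q (X'^T *m X')) ->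
  frobnorm (X *m Q) ^+ 2 <= (1 + frobnorm Q) * mxdot Q (X^T *m X).
Proof.
move=> Qs Qp; set l := 1 + _; have l0 : 0 < l by rewrite ltr_pwDl ?frobnorm_ge0.
set G := X *m Q; have := Qp (X + (- l^-1) *: G).
rewrite mxdot_gramD // -/G mxdotZr -frobnorm_sqr [(_ *: _)^T]linearZ /=.
rewrite -scalemxAl -scalemxAr !mxdotZr [X in _ + X]mulrA mulrNN => h.
have Ql : mxdot Q (G^T *m G) <= l * frobnorm G ^+ 2.
  apply: (le_trans (mxdot_gram_le _ _)).
  by rewrite ler_wpM2r ?sqr_ge0 // /l lerDr.
have {}Ql : l^-1 * l^-1 * mxdot Q (G^T *m G) <= l^-1 * frobnorm G ^+ 2.
  rewrite -mulrA ler_pM2l ?invr_gt0 // mulrC.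
  by rewrite ler_pdivrMr // mulrC.
rewrite -ler_pdivrMl //; lra.
Qed.

Lemma orthogonal_mulmx (R : realType) d (A B : 'M[R]_d) :
  A^T *m A = 1%:M -> B^T *m B = 1%:M -> (A *m B)^T *m (A *m B) = 1%:M.
Proof. by move=> A1 B1; rewrite trmx_mul mulmxA -(mulmxA _ A^T) A1 mulmx1. Qed.

(** * Rank and orientation of minimizers under small perturbations *)

Section Tightness.
Variables (R : realType) (d n : nat) (E : rel 'I_n.+1).
Variables (kappa tau : 'I_n.+1 -> 'I_n.+1 -> R).
Hypotheses (d_gt0 : (0 < d)%N) (Econn : weakly_connected E)
  (kappa_gt0 : forall i j, E i j -> 0 < kappa i j)
  (tau_gt0 : forall i j, E i j -> 0 < tau i j).
Variables (R0 : 'I_n.+1 -> 'M[R]_d) (t0 : 'I_n.+1 -> 'cV[R]_d).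
Hypothesis (R0_SO : forall i, SO (R0 i)).
Variable Q0 : 'M[R]_(pgdim d n.+1).
Hypothesis hQ0 : is_connection_laplacian E kappa tau
             (fun i j => (R0 i)^T *m R0 j)
             (fun i j => (R0 i)^T *m (t0 j - t0 i)) Q0.

Let feasible r (X : 'M[R]_(r, pgdim d n.+1)) :=
  forall i, (X *m selY R d i)^T *m (X *m selY R d i) = 1%:M.

(** The threshold is fixed before the number of rows [r]. Competitors may have any number of rows
    [s]: the true poses, with [d] rows, are one of them, while the first-order conditions use
    [s = r]. *)
Lemma minimizer_rank_det : exists2 eps : R, 0 < eps &
  forall Q : 'M[R]_(pgdim d n.+1), Q^T = Q -> frobnorm (Q - Q0) < eps ->
  forall r (X : 'M[R]_(r, pgdim d n.+1)),
    (0 < r)%N -> feasible X -> X *m selp R d ord0 = 0 ->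
    (forall s (X' : 'M[R]_(s, pgdim d n.+1)), feasible X' ->
      mxdot Q (X^T *m X) <= mxdot Q (X'^T *m X')) ->
  forall i,
    X *m selY R d i =
      X *m selY R d ord0 *m ((X *m selY R d ord0)^T *m (X *m selY R d i)) /\
    \det ((X *m selY R d ord0)^T *m (X *m selY R d i)) = 1.
Proof.
have [Q0s Q0E] := hQ0.
have R0o i : (R0 i)^T *m R0 i = 1%:M by case: (R0_SO i).
have [K K0 hK] := pgo_cost_coercive kappa_gt0 tau_gt0 t0 R0o Econn.
pose B := frobnorm (stack R0 t0) ^+ 2.
(* With [e = |Q - Q0|], [c1] and [c2] are chosen so that [<Q0, X^T X> <= e c1] and
   [|X Q|^2 <= e c2]. *)
pose c1 := 2%:R * (B + K * d%:R).
pose c2 := 2%:R * ((1 + frobnorm Q0) * c1) + 2%:R * (K * (d%:R + c1)).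
have B0 : 0 <= B := sqr_ge0 _.
have d0 : 0 <= d%:R :> R := ler0n _ _.
have Kd0 : 0 <= K * d%:R := mulr_ge0 (ltW K0) d0.
have c10 : 0 <= c1 by rewrite mulr_ge0 ?addr_ge0.
have q0 := frobnorm_ge0 Q0.
have c20 : 0 <= c2.
  by apply: addr_ge0; apply: mulr_ge0 => //; apply: mulr_ge0;
    rewrite ?addr_ge0 // ltW.
(* Each summand of [M] provides one smallness condition on [e]: [e <= 1], [e K <= 1/4], [e K c1 < 1]
   and [e (4 K)^2 c2 < 1]. *)
pose M := 1 + 4%:R * K + K * c1 + (4%:R * K) ^+ 2 * c2.
have Kc1 : 0 <= K * c1 := mulr_ge0 (ltW K0) c10.
have K2c2 : 0 <= (4%:R * K) ^+ 2 * c2 := mulr_ge0 (sqr_ge0 _) c20.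
have M0 : 0 < M by rewrite /M; lra.
exists M^-1 => [|Q Qs Qlt r X r0 Xf Xp0 Xmin]; first by rewrite invr_gt0.
set e := frobnorm (Q - Q0) in Qlt.
have e0 : 0 <= e := frobnorm_ge0 _.
have eM : e * M < 1 by rewrite -ltr_pdivlMr // div1r.
have eK := mulr_ge0 e0 (ltW K0); have eKc := mulr_ge0 e0 Kc1.
have eK2 := mulr_ge0 e0 K2c2.
have [e1 eK4 eKc1 eK2c2] : [/\ e <= 1, e * K <= 4%:R^-1, e * (K * c1) < 1 &
    e * ((4%:R * K) ^+ 2 * c2) < 1].
  have eME : e * M = e + 4%:R * (e * K) + e * (K * c1) +
    e * ((4%:R * K) ^+ 2 * c2) by rewrite /M; ring.
  by split; lra.
pose Y i := X *m selY R d i; pose p i := X *m selp R d i.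
have XE : X = stack Y p by rewrite stackK.
set c0 := mxdot Q0 (X^T *m X).
have cost0E s (X' : 'M[R]_(s, pgdim d n.+1)) : (0 < s)%N ->
  mxdot Q0 (X'^T *m X') = pgo_cost E kappa tau (fun i j => (R0 i)^T *m R0 j)
    (fun i j => (R0 i)^T *m (t0 j - t0 i))
    (fun i => X' *m selY R d i) (fun i => X' *m selp R d i).
  by move=> s0; rewrite -Q0E // stackK.
have Q0p (X' : 'M[R]_(r, pgdim d n.+1)) : 0 <= mxdot Q0 (X'^T *m X').
  by rewrite cost0E // pgo_cost_ge0.
have Y0d : frobnorm (Y ord0) ^+ 2 = d%:R by apply: frobnorm_semiorth; apply: Xf.
have [hKY hKX] := hK r Y p.
rewrite -cost0E // -/c0 in hKY hKX.
have {hKX} := hKX Xp0; rewrite -XE => xle; set x := frobnorm _ ^+ 2 in xle.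
have c00 : 0 <= c0 := Q0p X.
have x0 : 0 <= x := sqr_ge0 _.
have X0f : feasible (stack R0 t0) by move=> i; rewrite stack_selY.
have c0le1 : c0 <= e * (B + x).
  have -> : c0 = mxdot Q (X^T *m X) + mxdot (Q0 - Q) (X^T *m X).
    by rewrite mxdotBl addrC subrK.
  have -> : e * (B + x) = e * B + e * x by rewrite mulrDr.
  apply: lerD; last by rewrite /e frobnormC; exact: mxdot_gram_le.
  apply: (le_trans (Xmin _ _ X0f)).
  (* The noiseless cost vanishes at the true poses, so only the perturbation contributes. *)
  have -> : mxdot Q ((stack R0 t0)^T *m stack R0 t0) =
            mxdot (Q - Q0) ((stack R0 t0)^T *m stack R0 t0).
    by rewrite mxdotBl Q0E // (pgo_cost_true _ _ _ _ R0o) subr0.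
  exact: mxdot_gram_le.
rewrite Y0d in xle.
have ex := ler_wpM2l e0 xle.
have c0e : c0 <= e * c1.
  (* Combining both bounds gives [c0 <= e (B + K d) + e K c0]; since [e K <= 1/4], the last term is
     absorbed, and the factor 2 in [c1] covers the loss. *)
  have := ler_wpM2r c00 eK4; rewrite /c1 !mulrDr !mulrA in ex c0le1 *; lra.
have xc1 : x <= K * (d%:R + c1).
  apply: (le_trans xle); rewrite ler_pM2l // lerD2l.
  by apply: (le_trans c0e); rewrite ler_piMl.
pose lam := frobnorm (X *m Q).
have lam0 : 0 <= lam := frobnorm_ge0 _.
have lam2 : lam ^+ 2 <= e * c2.
  have lamD : lam <= frobnorm (X *m Q0) + frobnorm (X *m (Q - Q0)).
    by rewrite /lam -{1}(subrKC Q0 Q) mulmxDr frobnormD.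
  have h1 : frobnorm (X *m Q0) ^+ 2 <= (1 + frobnorm Q0) * (e * c1).
    apply: (le_trans (frobnorm_mulmx_psd_le _ Q0s Q0p)).
    by rewrite ler_wpM2l ?addr_ge0.
  have h2 : frobnorm (X *m (Q - Q0)) ^+ 2 <= e * (K * (d%:R + c1)).
    apply: (@le_trans _ _ (x * e ^+ 2)).
      rewrite /x -exprMn lerXn2r ?nnegrE ?mulr_ge0 ?frobnorm_ge0 //.
      exact: frobnormM.
    rewrite mulrC expr2 -mulrA ler_wpM2l //.
    by apply: (le_trans _ xc1); rewrite ler_piMl.
  apply: (@le_trans _ _ ((frobnorm (X *m Q0) + frobnorm (X *m (Q - Q0))) ^+ 2)).
    by rewrite lerXn2r ?nnegrE ?addr_ge0 ?frobnorm_ge0.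
  have := sqr_ge0 (frobnorm (X *m Q0) - frobnorm (X *m (Q - Q0))).
  rewrite /c2 sqrrB sqrrD !mulrDr !mulr2n in h1 h2 *; lra.
have Klam : K * lam <= 4%:R^-1.
  have : (4%:R * K * lam) ^+ 2 <= 1 ^+ 2.
    rewrite expr1n exprMn; apply: le_trans (ltW eK2c2).
    by rewrite [leRHS]mulrCA ler_wpM2l ?sqr_ge0.
  rewrite ler_pXn2r ?nnegrE ?mulr_ge0 // ?(ltW K0) //; lra.
have crit_p j : X *m Q *m selp R d j = 0.
  by apply: critical_translation => // X' Xf'; apply: Xmin.
have crit_Y j : X *m Q *m selY R d j = Y j *m ((X *m Q *m selY R d j)^T *m Y j).
  by apply: critical_rotation => // X' Xf'; apply: Xmin.
pose A := 1%:M - Y ord0 *m (Y ord0)^T.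
have AX0 : A *m X = 0.
  apply: frobnorm0_eq0; set W := A *m X.
  have WY0 : W *m selY R d ord0 = 0.
    rewrite /W /A -mulmxA mulmxBl mul1mx -mulmxA.
    by rewrite (Xf ord0 : (Y ord0)^T *m Y ord0 = 1%:M) mulmx1 subrr.
  have Wp0 : W *m selp R d ord0 = 0 by rewrite -mulmxA Xp0 mulmx0.
  have [_ /(_ Wp0)] := hK r (fun i => W *m selY R d i) (fun i => W *m selp R d i).
  rewrite stackK WY0 frobnorm0 expr0n add0r -cost0E //.
  have QW : mxdot Q (W^T *m W) <= lam * frobnorm W ^+ 2.
    apply: critical_quad_le crit_p crit_Y _ => // j.
    (* The multiplier is a block of [X Q] contracted by [(Y j)^T], hence of norm at most [lam]. *)
    rewrite -frobnorm_tr trmx_mul trmxK.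
    apply: (le_trans (frobnorm_trM_le _ (Xf j))); exact: frobnorm_selY_le.
  have Q0W : mxdot Q0 (W^T *m W) <= (lam + e) * frobnorm W ^+ 2.
    have -> : mxdot Q0 (W^T *m W) =
        mxdot Q (W^T *m W) + mxdot (Q0 - Q) (W^T *m W).
      by rewrite mxdotBl addrC subrK.
    by rewrite mulrDl lerD // /e frobnormC mxdot_gram_le.
  have W2 := sqr_ge0 (frobnorm W).
  (* Coercivity now reads [|W|^2 <= (K lam + e K) |W|^2], with a factor at most [1/2]. *)
  move=> /le_trans/(_ (ler_wpM2l (ltW K0) Q0W)).
  rewrite (_ : K * _ = K * lam * frobnorm W ^+ 2 + e * K * frobnorm W ^+ 2);
    last by ring.
  have := ler_wpM2r W2 Klam; have := ler_wpM2r W2 eK4; lra.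
move=> i; rewrite -/(Y i) -/(Y ord0); set Ri := _ *m Y i.
have YR : Y i = Y ord0 *m Ri.
  have : A *m Y i = 0 by rewrite /Y mulmxA AX0 mul0mx.
  by rewrite mulmxBl mul1mx -mulmxA => /subr0_eq.
(* [O] has the determinant of [Ri], the true rotations having determinant 1. It is compared with the
   identity through the rotation deviation that [hKY] controls. *)
split=> //; pose O := Ri *m (R0 i)^T *m R0 ord0.
have Rio : Ri^T *m Ri = 1%:M.
  have := Xf i; rewrite -/(Y i) YR trmx_mul mulmxA -(mulmxA _ (Y ord0)^T).
  by rewrite (Xf ord0 : (Y ord0)^T *m Y ord0 = 1%:M) mulmx1.
have detR j : \det (R0 j) = 1 by case: (R0_SO j).
suff : \det O = 1 by rewrite !det_mulmx det_tr !detR !mulr1.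
apply: orth_near1_det.
  apply: orthogonal_mulmx => //; apply: orthogonal_mulmx => //.
  by rewrite trmxK (mulmx1C (R0o i)).
have -> : O - 1%:M =
    (Y ord0)^T *m (Y i *m (R0 i)^T - Y ord0 *m (R0 ord0)^T) *m R0 ord0.
  rewrite mulmxBr (mulmxA _ (Y i)) (mulmxA _ (Y ord0)).
  by rewrite (Xf ord0 : (Y ord0)^T *m Y ord0 = 1%:M) mul1mx mulmxBl R0o.
rewrite frobnorm_orthMr //.
apply: (@le_lt_trans _ _ (K * c0)).
  apply: le_trans (hKY i).
  by rewrite lerXn2r ?nnegrE ?frobnorm_ge0 // frobnorm_trM_le // Xf.
apply: (@le_lt_trans _ _ (e * (K * c1))); last by apply: (lt_trans eKc1); lra.
by rewrite mulrCA ler_pM2l.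
Qed.
End Tightness.

(** * From factorized minimizers to the semidefinite program *)

Theorem theorem2 (R : realType) (d : nat) (hd : d = 2%N \/ d = 3%N)
    (n : nat) (E : rel 'I_n.+1)
    (Eirr : irreflexive E) (Econn : weakly_connected E)
    (kappa tau : 'I_n.+1 -> 'I_n.+1 -> R)
    (kappa_gt0 : forall i j, E i j -> 0 < kappa i j)
    (tau_gt0 : forall i j, E i j -> 0 < tau i j)
    (R0 : 'I_n.+1 -> 'M[R]_d) (t0 : 'I_n.+1 -> 'cV[R]_d)
    (R0_SO : forall i, SO (R0 i))
    (Q0 : 'M[R]_(pgdim d n.+1))
    (hQ0 : is_connection_laplacian E kappa tau
             (fun i j => (R0 i)^T *m R0 j)
             (fun i j => (R0 i)^T *m (t0 j - t0 i)) Q0) :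
  exists delta : R, 0 < delta /\
    forall (Rm : 'I_n.+1 -> 'I_n.+1 -> 'M[R]_d)
           (tm : 'I_n.+1 -> 'I_n.+1 -> 'cV[R]_d)
           (Q : 'M[R]_(pgdim d n.+1)),
      (forall i j, E i j -> SO (Rm i j)) ->
      is_connection_laplacian E kappa tau Rm tm Q ->
      specnorm (Q - Q0) < delta ->
      forall Z : 'M[R]_(pgdim d n.+1), sdp_minimizer Q Z ->
        exists (Rs : 'I_n.+1 -> 'M[R]_d) (ts : 'I_n.+1 -> 'cV[R]_d),
          pgo_optimal E kappa tau Rm tm Rs ts /\
          first_rows Z = stack Rs ts.
Proof.
have d_gt0 : (0 < d)%N by case: hd => ->.
have [eps eps0 heps] :=
  minimizer_rank_det d_gt0 Econn kappa_gt0 tau_gt0 R0_SO hQ0.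
have N_gt0 : (0 < pgdim d n.+1)%N by rewrite big_ord_recl addn1.
have NR_gt0 : 0 < (pgdim d n.+1)%:R :> R by rewrite ltr0n.
(* The divisor pays for passing from the spectral to the Frobenius norm. *)
exists (eps / (pgdim d n.+1)%:R); split; first exact: divr_gt0.
move=> Rm tm Q _ [Qs QE] Qlt Z [[Zpsd Zdiag] Zmin].
have {}Qlt : frobnorm (Q - Q0) < eps.
  apply: (le_lt_trans (frobnorm_le_specnorm _)).
  by rewrite mulrC -ltr_pdivlMr.
have [X ZE] := psd_gram Zpsd.
pose Y i := X *m selY R d i; pose p i := X *m selp R d i.
have XE : X = stack Y p by rewrite stackK.
have Yo i : (Y i)^T *m Y i = 1%:M by rewrite -gram_block -ZE.
(* The translated factor meets the normalization [p_1 = 0] at equal cost. Its Gram matrix may differ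
   from [Z], but the rotation blocks agree, and only they enter the conclusion drawn from it. *)
pose X1 := stack Y (fun i => p i - p ord0).
have X1Y i : X1 *m selY R d i = Y i by rewrite stack_selY.
have costX : mxdot Q Z = pgo_cost E kappa tau Rm tm Y p by rewrite ZE XE QE.
have costX1 : mxdot Q (X1^T *m X1) = mxdot Q Z.
  by rewrite costX QE // pgo_cost_shift.
have Zle s (X' : 'M[R]_(s, pgdim d n.+1)) :
    (forall i, (X' *m selY R d i)^T *m (X' *m selY R d i) = 1%:M) ->
    mxdot Q Z <= mxdot Q (X'^T *m X').
  move=> X'o; apply: Zmin; split=> [|i]; last by rewrite gram_block X'o.
  split=> [|x]; first by rewrite trmx_mul trmxK.
  rewrite mulmxA -mulmxA -trmx_mul -trace_mx11; exact: mxdot_ge0.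
have YR i : Y i = Y ord0 *m ((Y ord0)^T *m Y i) /\ \det ((Y ord0)^T *m Y i) = 1.
  rewrite -!X1Y; apply: (heps Q Qs Qlt _ X1) => //.
  - by move=> j; rewrite X1Y.
  - by rewrite stack_selp subrr.
  - by move=> s X' X'o; rewrite costX1; apply: Zle.
(* The first block row of [Z = X^T X] is [Y_1^T X], with the original translations [p]. *)
exists (fun i => (Y ord0)^T *m Y i), (fun i => (Y ord0)^T *m p i).
split; last by rewrite ZE gram_first_rows -/(Y ord0) XE mulmx_stack.
split=> [i|Rs' ts' Rs'_SO].
  have [YRi detRi] := YR i; split=> //.
  by rewrite trmx_mul trmxK -mulmxA -YRi Yo.
apply: (le_trans (pgo_cost_mull kappa_gt0 tau_gt0 _ _ _ _ (Yo ord0))).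
rewrite -costX -QE //; apply: Zle => i.
by rewrite stack_selY; case: (Rs'_SO i).
Qed.
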